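(* Let $G$ be a finite abelian group. A subset $Y\subset G$ is a difference set if and only if $Y\ne G$ and $Y$ is a pre-difference set.
   Context: Let $G$ be a finite group and $Y\subset G$. For $a\in G$ let $[a]$ be its conjugacy class, $\lambda_a:=\#\{(x,y)\in Y\times Y\mid x^{-1}y=a\}$ and $\lambda_{[a]}:=\#\{(x,y)\in Y\times Y\mid x^{-1}y\in[a]\}$. A non-empty proper subset $Y$ of $G$ is a $(v,k,\lambda)$-difference set if $v=\#G$, $k=\#Y$ and $\lambda_a=\lambda$ for every $a\in G$, $a\ne1$. A non-empty subset $Y$ of $G$ (possibly $Y=G$) is a $(v,k,\lambda)$ pre-difference set if $v=\#G$, $k=\#Y$ and $\lambda_{[a]}=\lambda\,\#[a]$ for every $a\in G$, $a\neq1$. $Y$ is a difference set (pre-difference set) if it is one for some $(v,k,\lambda)$. *)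

(* Defs.v *)
From mathcomp Require Import all_boot all_fingroup.

Set Implicit Arguments.
Unset Strict Implicit.
Unset Printing Implicit Defensive.

Import GroupScope.

Section DifferenceSets.

Variable gT : finGroupType.
Implicit Types (G : {group gT}) (Y : {set gT}) (a : gT).

Definition lambda_elt Y a : nat :=
  #|[set p in setX Y Y | p.1^-1 * p.2 == a]|.

Definition lambda_class G Y a : nat :=
  #|[set p in setX Y Y | p.1^-1 * p.2 \in a ^: G]|.

Definition is_vkl_difference_set G Y (v k l : nat) : Prop :=
  [/\ Y != set0, Y \proper G, v = #|G|, k = #|Y| &
      forall a, a \in G -> a != 1 -> lambda_elt Y a = l].

Definition is_vkl_pre_difference_set G Y (v k l : nat) : Prop :=
  [/\ Y != set0, Y \subset G, v = #|G|, k = #|Y| &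
      forall a, a \in G -> a != 1 -> lambda_class G Y a = (l * #|a ^: G|)%N].

Definition is_difference_set G Y : Prop :=
  exists v k l, is_vkl_difference_set G Y v k l.

Definition is_pre_difference_set G Y : Prop :=
  exists v k l, is_vkl_pre_difference_set G Y v k l.

End DifferenceSets.

(* Main.v *)
Require Import Defs.
From mathcomp Require Import all_boot all_fingroup.

Set Implicit Arguments.
Unset Strict Implicit.
Unset Printing Implicit Defensive.

Import GroupScope.

(** In an abelian group every conjugacy class is a singleton
    ([abelian_classP]), so [lambda_class] and [lambda_elt] count the same pairs
    ([lambda_class_cent]) and the factor [#|a ^: G|] is 1: the two counting
    conditions coincide. What remains to compare is properness, and a subset
    of [G] is proper exactly when it differs from [G]. *)

Lemma lambda_class_cent (gT : finGroupType) (G : {group gT})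
    (Y : {set gT}) (a : gT) :
  a \in 'C(G) -> lambda_class G Y a = lambda_elt Y a.
Proof.
move=> /cent_classP clGa; rewrite /lambda_class /lambda_elt clGa.
by apply: eq_card => p; rewrite !inE.
Qed.

Theorem proposition1p5 (gT : finGroupType) (G : {group gT}) (Y : {set gT})
    (abG : abelian G) (sYG : Y \subset G) :
  is_difference_set G Y <-> (Y <> G :> {set gT} /\ is_pre_difference_set G Y).
Proof.
have cGG a : a \in G -> a \in 'C(G) by apply: (subsetP abG).
have cl1 a : a \in G -> #|a ^: G| = 1%N.
  by move=> aG; rewrite (abelian_classP _ abG) // cards1.
split=> [[v [k [l [Yn0 prYG _ _ lamY]]]] |
         [neqYG [v [k [l [Yn0 _ _ _ lamY]]]]]].
  split; first by move=> eqYG; rewrite eqYG properxx in prYG.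
  exists #|G|, #|Y|, l; split=> // a aG an1.
  by rewrite lambda_class_cent ?cGG // cl1 // muln1 lamY.
exists #|G|, #|Y|, l; split=> // [|a aG an1].
  by rewrite properEneq sYG andbT; apply/eqP.
by rewrite -(lambda_class_cent Y (cGG a aG)) lamY // cl1 // muln1.
Qed.
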